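(* Let $K$ be a non-Archimedean local field with residue field of cardinality $q$ and normalized absolute value $|\cdot|_K$, let $\alpha>0$, $u_0\in\mathbb R$, and let $f:\ q^{\mathbb Z}\times\mathbb R\to\mathbb R$ satisfy, with some constants $M,F>0$, $$|f(|t|_K,x)|\le M,\qquad |f(|t|_K,x)-f(|t|_K,y)|\le F|x-y|$$ for all $t\in K\setminus\{0\}$ and $x,y\in\mathbb R$. Suppose in addition that $$|f(q^l,x)-f(q^l,y)|\le F_l|x-y|,\qquad x,y\in\mathbb R,\ l\in\mathbb Z,$$ where $0<F_l<q^{-\alpha l}$ for each $l\in\mathbb Z$. Let $u$ be a local solution of the integral equation $$u(|t|_K)=u_0+I^\alpha\big[f(|\cdot|_K,u(|\cdot|_K))\big](|t|_K),$$ that is, a real-valued radial function satisfying this equation for $|t|_K\le q^N$, with some $N\in\mathbb Z$. Then $u$ admits a continuation to a global solution of this integral equation, defined for all $t\in K$.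
   Context: $K$ is a non-Archimedean local field (a non-discrete totally disconnected locally compact topological field); the normalized absolute value satisfies $|\beta|_K=q^{-1}$ for a generator $\beta$ of the maximal ideal of the ring of integers $O=\{x\in K:|x|_K\le 1\}$, and takes the values $0$ and $q^n$, $n\in\mathbb Z$. $dx$ is the Haar measure on the additive group of $K$ with $\int_O dx=1$. A radial function is a function of the form $x\mapsto u(|x|_K)$; it is identified with the function $|x|_K\mapsto u(|x|_K)$ on $q^{\mathbb Z}$ (together with its value $u(0)$ at the origin). The operator $I^\alpha$ is defined by $(I^\alpha\varphi)(0)=0$ and, for $x\neq 0$, $$(I^\alpha\varphi)(x)=\frac{1-q^{-\alpha}}{1-q^{\alpha-1}}\int_{|y|_K\le|x|_K}\big(|x-y|_K^{\alpha-1}-|y|_K^{\alpha-1}\big)\varphi(y)\,dy,\quad\alpha\ne1,$$ $$(I^1\varphi)(x)=\frac{1-q}{q\log q}\int_{|y|_K\le|x|_K}\big(\log|x-y|_K-\log|y|_K\big)\varphi(y)\,dy .$$ For a radial function $\varphi=\varphi(|x|_K)$ with $\sum_{k\le m}\max(q^k,q^{\alpha k})|\varphi(q^k)|<\infty$ (if $\alpha\ne1$), respectively $\sum_{k\le m}|k|q^k|\varphi(q^k)|<\infty$ (if $\alpha=1$), for some $m\in\mathbb Z$, the function $I^\alpha\varphi$ exists and is radial, and for $x\ne0$ $$(I^\alpha\varphi)(|x|_K)=q^{-\alpha}|x|_K^\alpha\varphi(|x|_K)+\frac{1-q^{-\alpha}}{1-q^{\alpha-1}}\int_{|y|_K<|x|_K}\big(|x|_K^{\alpha-1}-|y|_K^{\alpha-1}\big)\varphi(|y|_K)\,dy,\quad\alpha\neq1,$$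 $$(I^1\varphi)(|x|_K)=q^{-1}|x|_K\varphi(|x|_K)+\frac{1-q}{q\log q}\int_{|y|_K<|x|_K}\big(\log|x|_K-\log|y|_K\big)\varphi(|y|_K)\,dy .$$ Computing $(I^\alpha\varphi)(|t|_K)$ for $|t|_K\le q^m$ requires only the values of $\varphi$ on $\{0<|t|_K\le q^m\}$, so solutions of the integral equation on a ball $\{|t|_K\le q^m\}$ make sense. *)

(* Defs.v *)
From HB Require Import structures.
From mathcomp Require Import all_boot all_order all_algebra.
From mathcomp Require Import all_classical all_reals all_analysis.

Set Implicit Arguments.
Unset Strict Implicit.
Unset Printing Implicit Defensive.

Import Order.TTheory GRing.Theory Num.Theory.
Import numFieldNormedType.Exports.

Local Open Scope classical_set_scope.
Local Open Scope ring_scope.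

HB.mixin Record isTopologicalField K & Topological K & GRing.Field K := {
  tf_mul_continuous : continuous (fun x : K * K => x.1 * x.2) ;
  tf_inv_continuous : forall x : K, x != 0 -> {for x, continuous (@GRing.inv K)}
}.

#[short(type="topologicalFieldType")]
HB.structure Definition TopologicalField :=
  {K of GRing.Field K & TopologicalZmodule K & isTopologicalField K}.

(* K with 0 as base point: generated sigma-algebras are defined in the library
   on pointed types only. *)
Definition pointed_field (K : topologicalFieldType) : Type := K.
HB.instance Definition _ (K : topologicalFieldType) :=
  Choice.on (pointed_field K).
HB.instance Definition _ (K : topologicalFieldType) :=
  isPointed.Build (pointed_field K) (0 : K).

Definition nonarchimedean_local_field (K : topologicalFieldType) : Prop :=
  [/\ hausdorff_space K,
      locally_compact [set: K],
      totally_disconnected [set: K]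
    & ~ open [set (0 : K)]].

Notation borelType K := (@g_sigma_algebraType (pointed_field K) (@open K)).

Section LocalField.
Context {R : realType} {K : topologicalFieldType}.
Variable abs : K -> R.

Definition integers : set K := [set x | abs x <= 1].

Definition maximal_ideal : set K := [set x | abs x < 1].

(* The elements of the residue field O / P, as subsets of K. *)
Definition residue_classes : set (set K) :=
  [set [set x + y | y in maximal_ideal] | x in integers].

(* [abs] is the normalized absolute value of K and q is the cardinality of the
   residue field: an ultrametric absolute value that defines the topology of K
   and takes the value 1/q at a generator of the maximal ideal. *)
Record normalized_absolute_value (q : nat) : Prop := {
  nabs_ge0 : forall x, 0 <= abs x ;
  nabs_eq0 : forall x, abs x = 0 <-> x = 0 ;
  nabsM : forall x y, abs (x * y) = abs x * abs y ;
  nabsD : forall x y, abs (x + y) <= Num.max (abs x) (abs y) ;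
  nabs_nbhs : forall x : K,
    nbhs x = filter_from [set r : R | 0 < r]
                         (fun r => [set y | abs (x - y) < r]) ;
  nabs_residue : (residue_classes #= `I_q)%card ;
  nabs_uniformizer : exists2 beta : K,
    maximal_ideal = [set beta * y | y in integers] & abs beta = q%:R^-1 ;
  nabs_range : range abs = 0 |` [set q%:R ^ n | n in [set: int]]
}.

(* Finiteness on compact sets and positivity on nonempty open sets follow from
   the normalization, the ring of integers being a compact open subgroup. *)
Definition normalized_haar_measure
    (mu : {measure set (borelType K) -> \bar R}) : Prop :=
  (forall (x : K) (A : set (borelType K)), measurable A ->
      mu [set (x + y : K) | y in A] = mu A)
  /\ mu integers = 1%E.

Definition radial_on (D : set K) (u : K -> R) : Prop :=
  exists w : R -> R, forall x, D x -> u x = w (abs x).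

Section Integral.
Variables (q : nat) (mu : {measure set (borelType K) -> \bar R}) (alpha : R).

Definition Icoef : R :=
  if alpha == 1 then (1 - q%:R) / (q%:R * ln q%:R)
  else (1 - q%:R `^ (- alpha)) / (1 - q%:R `^ (alpha - 1)).

(* The values at y = x and y = 0, where the formula may be meaningless, are
   conventional; this concerns a set of measure zero. *)
Definition Ikernel (x y : K) : R :=
  if alpha == 1 then ln (abs (x - y)) - ln (abs y)
  else abs (x - y) `^ (alpha - 1) - abs y `^ (alpha - 1).

Definition Iop (phi : K -> R) (x : K) : R :=
  if x == 0 then 0
  else Icoef * \int[mu]_(y in [set y | abs y <= abs x]) (Ikernel x y * phi y).

(* [Iop] is a total function; its integral is meaningful at x <> 0 when this
   holds. *)
Definition Iop_exists (phi : K -> R) (x : K) : Prop :=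
  mu.-integrable [set y | abs y <= abs x]
    (fun y => (Ikernel x y * phi y)%:E).

(* u is a radial solution, on the set D, of
     u(|t|) = u0 + I^alpha [f(|.|, u(|.|))] (|t|).
   For D a ball around 0, only the values of u on D matter.  The value f 0 is
   used only on the null set {0}. *)
Definition solution_on (D : set K) (u0 : R) (f : R -> R -> R) (u : K -> R)
    : Prop :=
  [/\ radial_on D u,
      forall t, D t -> t != 0 -> Iop_exists (fun y => f (abs y) (u y)) t
    & forall t, D t -> u t = u0 + Iop (fun y => f (abs y) (u y)) t].

End Integral.
End LocalField.

(* Main.v *)
Require Import Defs.
From mathcomp Require Import all_boot all_order all_algebra.
From mathcomp Require Import all_classical all_reals all_analysis.
From mathcomp Require Import measurable_realfun ring lra.

Set Implicit Arguments.
Unset Strict Implicit.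
Unset Printing Implicit Defensive.

Import Order.TTheory GRing.Theory Num.Theory.
Import numFieldNormedType.Exports.

Local Open Scope classical_set_scope.
Local Open Scope ring_scope.

(** Write [g r] for [r `^ (alpha - 1)], or for [ln r] when [alpha = 1], so that
    the kernel of the operator is [g |x - y| - g |y|].  Translation by [x]
    preserves both the Haar measure and every ball containing [x], so this
    kernel has integral 0 over the ball [|y| <= |x|] ([Rintegral_Ikernel]); the
    two terms are separately integrable because a ball of radius [q ^ n] has
    measure [q ^ n] ([measure_ball]) and [s > -1] makes the geometric series
    behind the integral of [|y| `^ s] converge ([integrable_abs_powR]).

    Hence, for a bounded radial [phi], the function [phi] may be replaced by
    [phi - phi x] under the integral.  That difference vanishes on the sphere of
    [x], and inside the sphere [|x - y| = |x|].  With [c] the coefficient of the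
    operator,
      [I phi x = c * (J - phi x * D)],
    where [D] is the integral of [g |x| - g |y|] over the ball of [x] and [J]
    that of [(g |x| - g |y|) * phi y] ([Iop_radialE]).  The integrand of [J]
    vanishes on the sphere of [x], so [J] is determined by the values of [phi]
    strictly inside it.

    A solution [u] on a ball therefore extends by a constant [z] to the next
    sphere, of radius [r], exactly when [z = u0 + c * (J - f r z * D)], where
    [J] depends on [u] only.  The right-hand side is a bounded continuous
    function of [z], so the intermediate value theorem provides a fixed point
    ([solution_extend_sphere]).  Iterating exhausts the field, and the
    extensions glue because the equation at [t] involves only the ball of [t]
    ([solution_glue]). *)

(** * The absolute value and its balls *)

Section LocalFieldTheory.
Context {R : realType} {K : topologicalFieldType} {q : nat} {abs : K -> R}.
Hypothesis habs : normalized_absolute_value abs q.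
Implicit Types (x y z t : K) (n m : int).

Definition Kball n : set K := [set y | abs y <= q%:R ^ n].

Lemma abs_ge0 x : 0 <= abs x. Proof. exact: (nabs_ge0 habs). Qed.

Lemma abs0 : abs 0 = 0. Proof. by apply/(nabs_eq0 habs). Qed.

Lemma abs_gt0 x : (0 < abs x) = (x != 0).
Proof.
rewrite lt_def abs_ge0 andbT; congr (~~ _).
by apply/eqP/eqP => /(nabs_eq0 habs).
Qed.

Lemma abs1 : abs 1 = 1.
Proof.
have h : abs 1 != 0 by rewrite gt_eqF// abs_gt0 oner_neq0.
by apply: (mulfI h); rewrite -(nabsM habs) !mulr1.
Qed.

Lemma absN x : abs (- x) = abs x.
Proof.
suff h : abs (-1) = 1 by rewrite -mulN1r (nabsM habs) h mul1r.
have /eqP := abs1; rewrite -[X in abs X]mulr1 -mulrNN (nabsM habs) -expr2.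
by rewrite sqrf_eq1 => /orP[/eqP//|/eqP h]; have := abs_ge0 (-1); rewrite h ler0N1.
Qed.

Lemma absB x y : abs (x - y) = abs (y - x).
Proof. by rewrite -absN opprB. Qed.

Lemma absV x : abs x^-1 = (abs x)^-1.
Proof.
have [->|x0] := eqVneq x 0; first by rewrite invr0 abs0 invr0.
have h : abs x != 0 by rewrite gt_eqF// abs_gt0.
by apply: (mulfI h); rewrite -(nabsM habs) !divff// abs1.
Qed.

Lemma abs_leD x y r : abs x <= r -> abs y <= r -> abs (x + y) <= r.
Proof. by move=> hx hy; apply: le_trans (nabsD habs x y) _; rewrite ge_max hx. Qed.

Lemma abs_leB x y r : abs x <= r -> abs y <= r -> abs (x - y) <= r.
Proof. by move=> hx hy; apply: abs_leD => //; rewrite absN. Qed.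

(** In an ultrametric triangle the two longest sides are equal. *)
Lemma abs_subl x y : abs y < abs x -> abs (x - y) = abs x.
Proof.
move=> xy; apply/eqP; rewrite eq_le abs_leB ?(ltW xy)//=.
have := nabsD habs (x - y) y; rewrite subrK le_max => /orP[//|].
by rewrite leNgt xy.
Qed.

Lemma residue_class_eq x y : abs (x - y) < 1 ->
  [set x + z | z in maximal_ideal abs] = [set y + z | z in maximal_ideal abs].
Proof.
have sub a b : abs (a - b) < 1 ->
    [set a + z | z in maximal_ideal abs] `<=` [set b + z | z in maximal_ideal abs].
  move=> ab _ [z /= hz <-]; exists (a - b + z); last by rewrite addrA subrKC.
  by apply: le_lt_trans (nabsD habs _ _) _; rewrite gt_max ab.
by move=> xy; apply/seteqP; split; apply: sub; rewrite // absB.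
Qed.

Lemma card_residue_gt1 : (1 < q)%N.
Proof.
have q0 : (0 < q)%N.
  rewrite lt0n; apply/eqP => q0; have := nabs_residue habs.
  rewrite q0 II0 card_eq0 => /eqP/seteqP[h _].
  have [] := h [set 0 + y | y in maximal_ideal abs].
  by exists 0 => //=; rewrite /integers/= abs0 ler01.
have [b hP hb] := nabs_uniformizer habs.
have : maximal_ideal abs b by rewrite hP; exists 1; rewrite ?mulr1//= /integers/= abs1.
by rewrite /maximal_ideal/= hb invf_lt1 ?ltr0n// ltr1n.
Qed.

Let q1 : 1 < q%:R :> R. Proof. by rewrite ltr1n card_residue_gt1. Qed.
Let q0 : 0 < q%:R :> R. Proof. exact: lt_trans ltr01 q1. Qed.

Lemma abs_range x : x != 0 -> exists n, abs x = q%:R ^ n.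
Proof.
rewrite -abs_gt0 => x0.
have : range abs (abs x) by exists x.
rewrite (nabs_range habs) => -[/= h|[n _ <-]]; last by exists n.
by rewrite h ltxx in x0.
Qed.

Lemma abs_surj n : exists2 x, x != 0 & abs x = q%:R ^ n.
Proof.
have : range abs (q%:R ^ n) by rewrite (nabs_range habs); right; exists n.
by move=> [x _ hx]; exists x => //; rewrite -abs_gt0 hx exprz_gt0.
Qed.

Lemma abs_lt_exprz x n : (abs x < q%:R ^ n) = (abs x <= q%:R ^ (n - 1)).
Proof.
have [->|/abs_range[m ->]] := eqVneq x 0.
  by rewrite abs0 exprz_gt0// exprz_ge0// ltW.
by rewrite ltr_eXz2l// ler_eXz2l// lerBrDr lezD1.
Qed.

Lemma ball_exhaust n x : exists k : nat, Kball (n + k%:Z) x.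
Proof.
have [->|/abs_range[m hm]] := eqVneq x 0.
  by exists 0%N; rewrite /Kball/= abs0 exprz_ge0// ltW.
exists `|m - n|%N; rewrite /Kball/= hm ler_eXz2l//.
by rewrite -lerBlDl; exact: lez_abs.
Qed.

Lemma ball_homo n m : n <= m -> Kball n `<=` Kball m.
Proof. by move=> nm x /= /le_trans; apply; rewrite ler_eXz2l. Qed.

Lemma ball_trans n x y : abs y <= abs x -> Kball n x -> Kball n y.
Proof. exact: le_trans. Qed.

Lemma abs_ball_top n x : Kball n x -> ~ Kball (n - 1) x -> abs x = q%:R ^ n.
Proof.
rewrite /Kball/= -abs_lt_exprz => h /negP; rewrite -leNgt => h'.
by apply/eqP; rewrite eq_le h.
Qed.

(** * Measurability and measure of balls *)

(** Spheres of positive radius are open, hence so are their unions. *)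
Lemma open_punctured_radial x (P : set R) :
  open [set y | y != x /\ P (abs (y - x))].
Proof.
rewrite openE => y [/= yx Py]; rewrite /interior (nabs_nbhs habs).
have xy0 : 0 < abs (y - x) by rewrite abs_gt0 subr_eq0.
exists (abs (y - x)) => //= z /= zy; rewrite /mkset.
have -> : z - x = (y - x) - (y - z) by rewrite opprB [RHS]addrC subrKA.
rewrite abs_subl//; split=> //; apply/negP => /eqP zx.
by move: zy; rewrite zx ltxx.
Qed.

(** Any set of radii, Borel or not, gives a Borel set: spheres of positive
    radius are open, and the remaining point [x] is closed. *)
Lemma measurable_radial_set x (P : set R) :
  measurable ([set y | P (abs (y - x))] : set (borelType K)).
Proof.
have mo (A : set K) : open A -> measurable (A : set (borelType K)).
  by move=> oA; exact: sub_sigma_algebra.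
have m1 : measurable ([set x] : set (borelType K)).
  rewrite -[X in measurable X]setCK; apply: measurableC; apply: mo.
  suff -> : ~` [set x] = [set y | y != x /\ setT (abs (y - x))].
    exact: open_punctured_radial.
  by apply/seteqP; split => y /=; [move=> /eqP|move=> [/eqP]].
have [P0|P0] := pselect (P 0).
- suff -> : [set y | P (abs (y - x))] =
      [set y | y != x /\ P (abs (y - x))] `|` [set x].
    by apply: measurableU => //; apply: mo; exact: open_punctured_radial.
  apply/seteqP; split => y /=.
    by move=> Py; have [->|] := eqVneq y x; [right|left].
  by move=> [[]//|->]; rewrite subrr abs0.
- suff -> : [set y | P (abs (y - x))] = [set y | y != x /\ P (abs (y - x))].
    by apply: mo; exact: open_punctured_radial.
  apply/seteqP; split => y /=; last by case.
  move=> Py; split => //; apply/eqP => yx; apply: P0.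
  by move: Py; rewrite yx subrr abs0.
Qed.

Lemma measurable_radial_fun d (T : measurableType d) x (h : R -> T) :
  measurable_fun [set: borelType K] (fun y : K => h (abs (y - x))).
Proof.
by move=> _ Y _; rewrite setTI; exact: (measurable_radial_set x (h @^-1` Y)).
Qed.

Lemma measurable_radial_fun0 d (T : measurableType d) (h : R -> T) :
  measurable_fun [set: borelType K] (fun y : K => h (abs y)).
Proof.
rewrite (_ : (fun y => _) = (fun y : K => h (abs (y - 0)))); last first.
  by apply/funext => y; rewrite subr0.
exact: measurable_radial_fun.
Qed.

Lemma measurable_le_abs (r : R) :
  measurable ([set y | abs y <= r] : set (borelType K)).
Proof.
rewrite (_ : [set y | _] = [set y | [set s | s <= r] (abs (y - 0))]).
  exact: measurable_radial_set.
by apply/seteqP; split => y /=; rewrite subr0.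
Qed.

Variable mu : {measure set (borelType K) -> \bar R}.
Hypothesis hmu : normalized_haar_measure abs mu.

Lemma haar_translate (a : K) (A : set K) :
  measurable (A : set (borelType K)) -> mu [set a + y | y in A] = mu A.
Proof. by case: hmu => h _; exact: h. Qed.

(** Multiplication by an element of absolute value [q ^ n] carries the
    decomposition of the ring of integers into residue classes to a
    decomposition of the ball into [q] translates of the next smaller one. *)
Lemma measure_ballS n : mu (Kball n) = (q%:R%:E * mu (Kball (n - 1)))%E.
Proof.
have [g [gfun ginj gsurj]] : exists g : nat -> set K,
    set_bij `I_q (residue_classes abs) g.
  by apply/card_set_bijP; rewrite card_eq_sym; exact: nabs_residue habs.
have /choice[e he] : forall i, exists x, (i < q)%N ->
    integers abs x /\ g i = [set x + y | y in maximal_ideal abs].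
  move=> i; have [iq|iq] := pselect (i < q)%N; last by exists 0.
  by have [x hx <-] := gfun i iq; exists x.
have [b b0 hb] := abs_surj n.
pose F i : set K := [set y | abs (y - b * e i) <= q%:R ^ (n - 1)].
have FE i : F i = [set b * e i + y | y in Kball (n - 1)].
  apply/seteqP; split => y /=; last by move=> [z hz <-]; rewrite /F/= addrC addKr.
  by move=> hy; exists (y - b * e i) => //; rewrite addrC subrK.
have -> : Kball n = \bigcup_(i in `I_q) F i.
  apply/seteqP; split => y /=.
    move=> hy; have : residue_classes abs [set b^-1 * y + z | z in maximal_ideal abs].
      exists (b^-1 * y) => //; rewrite /integers/= (nabsM habs) absV hb.
      by rewrite mulrC ler_pdivrMr ?exprz_gt0// mul1r.
    move=> /gsurj[i iq gi]; exists i => //.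
    have : g i (b^-1 * y).
      by rewrite gi; exists 0; rewrite ?addr0// /maximal_ideal/= abs0.
    have [_ ->] := he _ iq; move=> [z hz zE].
    rewrite /F/= -abs_lt_exprz -[y](mulVKf b0) -zE -mulrBr addrC addKr (nabsM habs) hb.
    by rewrite gtr_pMr// exprz_gt0.
  move=> [i iq]; rewrite /F/= -abs_lt_exprz => hy.
  rewrite /Kball/= -(subrK (b * e i) y); apply: abs_leD; first exact: ltW.
  by rewrite (nabsM habs) hb ger_pMr ?exprz_gt0//; case: (he _ iq).
rewrite measure_fin_bigcup//.
- rewrite (eq_fsbigr (fun=> mu (Kball (n - 1)))).
    by rewrite -fsbig_ord sumr_const card_ord mule_natl.
  by move=> i _; rewrite FE; exact: (haar_translate _ (measurable_le_abs _)).
- move=> i j iq jq [y []]; rewrite /F/= -!abs_lt_exprz => yi yj.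
  apply: ginj; rewrite ?inE//.
  have eij : abs (e i - e j) < 1.
    have : abs (b * (e i - e j)) < q%:R ^ n.
      rewrite mulrBr (_ : _ - _ = (y - b * e j) - (y - b * e i)).
        by rewrite abs_lt_exprz; apply: abs_leB; rewrite -abs_lt_exprz.
      by rewrite opprB [RHS]addrC subrKA.
    by rewrite (nabsM habs) hb gtr_pMr// exprz_gt0.
  have [_ ->] := he _ iq; have [_ ->] := he _ jq; exact: residue_class_eq.
- by move=> i _; exact: (measurable_radial_set _ [set r | r <= q%:R ^ (n - 1)]).
Qed.

(** Induction in both directions from the ring of integers, of measure 1.
    Downwards, the smaller ball has finite measure because the larger one has. *)
Lemma measure_ball n : mu (Kball n) = (q%:R ^ n)%:E.
Proof.
have up k : mu (Kball k) = (q%:R ^ k)%:E -> mu (Kball (k + 1)) = (q%:R ^ (k + 1))%:E.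
  move=> h; rewrite measure_ballS addrK h -EFinM exprzDr ?expr1z ?unitfE ?gt_eqF//.
  by rewrite mulrC.
have dn k : mu (Kball k) = (q%:R ^ k)%:E -> mu (Kball (k - 1)) = (q%:R ^ (k - 1))%:E.
  rewrite measure_ballS => h; have : mu (Kball (k - 1)) \is a fin_num.
    rewrite ge0_fin_numE// ltNge leye_eq; apply/negP => /eqP h'.
    by move: h; rewrite h' gt0_muley ?lte_fin.
  move=> /fineK h'; move: h; rewrite -h' -EFinM => -[] h; congr EFin.
  apply: (mulfI (lt0r_neq0 q0)); rewrite h.
  by rewrite exprzDr ?unitfE ?gt_eqF// exprN1 mulrCA divff ?mulr1 ?gt_eqF.
elim: n => [|n IH|n IH].
- rewrite expr0z; case: hmu => _ <-; congr (mu _).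
- by rewrite -addn1 PoszD; exact: up.
- by rewrite -addn1 PoszD opprD; exact: dn.
Qed.

(** * Integrability of the kernel *)

Lemma haar_le (A B : set (borelType K)) : measurable A -> measurable B ->
  A `<=` B -> (mu A <= mu B)%E.
Proof. by move=> mA mB; apply: le_measure; rewrite inE. Qed.

(** On the sphere of radius [q ^ (n - k)], whose measure is at most that of the
    ball of the same radius, the integral is at most [c * z ^+ k] with ratio
    [z = q `^ (- (s + 1)) < 1]. *)
Lemma integrable_abs_powR (s : R) n : -1 < s ->
  mu.-integrable (Kball n) (fun y => (abs y `^ s)%:E).
Proof.
move=> s1; pose h (y : borelType K) : \bar R := (abs y `^ s)%:E.
have mh : measurable_fun [set: borelType K] h.
  exact: (measurable_radial_fun0 (fun r => (r `^ s)%:E)).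
have h0 y : (0 <= h y)%E by rewrite lee_fin powR_ge0.
pose S (k : nat) : set K := [set y | abs y = q%:R ^ (n - k%:Z)].
have mS k : measurable (S k : set (borelType K)).
  rewrite (_ : S k = [set y | [set r | r = q%:R ^ (n - k%:Z)] (abs (y - 0))]).
    exact: measurable_radial_set.
  by apply/seteqP; split => y /=; rewrite subr0.
have m0 : measurable ([set 0] : set (borelType K)).
  rewrite (_ : [set 0] = [set y | abs y <= 0]); first exact: measurable_le_abs.
  apply/seteqP; split => y /=; first by move=> ->; rewrite abs0.
  by rewrite le_eqVlt ltNge abs_ge0 orbF => /eqP/(nabs_eq0 habs).
have ballE : Kball n = [set 0] `|` \bigcup_k S k.
  apply/seteqP; split => y.
    have [->|/abs_range[m hm]] := eqVneq y 0; first by left.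
    rewrite /Kball/= hm ler_eXz2l// => mn; right; exists `|n - m|%N => //.
    by rewrite /S/= hm gez0_abs ?subr_ge0// subKr.
  move=> -[/= ->|[k _]]; rewrite /Kball/=; first by rewrite abs0 exprz_ge0// ltW.
  by rewrite /S/= => ->; rewrite ler_eXz2l// lerBlDr lerDl.
have mU : measurable (\bigcup_k S k : set (borelType K)) by exact: bigcup_measurable.
apply/integrableP; split; first exact: measurable_funTS.
rewrite (eq_integral h); last by move=> y _; rewrite gee0_abs ?h0.
rewrite ballE ge0_integral_setU//=; last 2 first.
- exact: measurable_funTS.
- apply/disj_setPS => y [/= -> [k _]]; rewrite /S/= abs0 => /esym/eqP.
  by rewrite gt_eqF// exprz_gt0.
apply: lte_add_pinfty.
  (* The origin: it lies in a ball of finite measure, and [h 0] is finite. *)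
  rewrite (eq_integral (cst (h 0))); last by move=> y /set_mem ->.
  rewrite integral_cst//; apply: lte_mul_pinfty => //.
  apply: (@le_lt_trans _ _ (mu (Kball n))); last by rewrite measure_ball ltry.
  by apply: haar_le => //; [exact: measurable_le_abs|rewrite ballE; left].
rewrite ge0_integral_bigcup//; last 2 first.
- exact: measurable_funTS.
- move=> i j _ _ [y []]; rewrite /S/= => -> /eqP.
  by move=> /eqP/(ieexprIz q0); rewrite gt_eqF// => /(_ isT)/addrI/oppr_inj[].
pose z : R := q%:R `^ (- (s + 1)); pose c : R := q%:R `^ (n%:~R * (s + 1)).
have z01 : 0 < z < 1.
  rewrite /z powR_gt0//= powRN invf_lt1 ?powR_gt0// /powR gt_eqF// expR_gt1.
  by rewrite mulr_gt0 ?ln_gt0// -ltrBlDr sub0r.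
apply: (@le_lt_trans _ _ (\sum_(0 <= k <oo) (geometric c z k)%:E)%E).
  apply: lee_nneseries => k _; first by move=> *; apply: integral_ge0.
  rewrite (eq_integral (cst ((q%:R ^ (n - k%:Z)) `^ s)%:E)); last first.
    by move=> y /set_mem; rewrite /h /S/= => ->.
  rewrite integral_cst//.
  apply: (@le_trans _ _ (((q%:R ^ (n - k%:Z)) `^ s)%:E * mu (Kball (n - k%:Z)))%E).
    apply: lee_wpmul2l; first by rewrite lee_fin powR_ge0.
    apply: haar_le => //; first exact: measurable_le_abs.
    by move=> y; rewrite /S/Kball/= => ->.
  rewrite measure_ball -EFinM lee_fin /geometric/= -!powR_intmul ?(ltW q0)//.
  rewrite -(powR_mulrn k (powR_ge0 _ _)) -!powRrM -!powRD ?(gt_eqF q0) ?implybT//.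
  by rewrite intrB le_eqVlt; apply/orP; left; apply/eqP; congr (_ `^ _); ring.
apply: (@le_lt_trans _ _ (c / (1 - z))%:E); last exact: ltry.
apply: lime_le; first by apply: is_cvg_nneseries => k *;
  rewrite lee_fin mulr_ge0 ?powR_ge0// exprn_ge0// powR_ge0.
apply: nearW => k; rewrite sumEFin lee_fin.
case/andP: z01 => z0 z1; rewrite -[leLHS]/(series (geometric c z) k).
rewrite geometric_seriesE ?lt_eqF//= ler_wpM2r ?invr_ge0 ?subr_ge0 ?(ltW z1)//.
by rewrite ler_piMr ?powR_ge0// gerBl exprn_ge0// ltW.
Qed.

Lemma abs_sub_ball n x y : Kball n x -> Kball n (y - x) <-> Kball n y.
Proof.
move=> hx; split=> hy; last exact: abs_leB.
by rewrite -(subrK x y); exact: abs_leD.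
Qed.

(** Translation invariance says that [y |-> |y|] and [y |-> |y - x|] push the
    Haar measure forward to the same measure on the reals, and both map exactly
    the points of the ball to radii at most [q ^ n]. *)
Lemma ge0_integral_radial_translate n x (h : R -> \bar R) :
  measurable_fun [set: R] h -> (forall r, (0 <= h r)%E) -> Kball n x ->
  (\int[mu]_(y in Kball n) h (abs (y - x)%R) = \int[mu]_(y in Kball n) h (abs y))%E.
Proof.
move=> mh h0 hx; pose D : set R := [set r | r <= q%:R ^ n].
have mD : measurable D by rewrite /D -set_itvNyc; exact: measurable_itv.
pose p1 (y : borelType K) : R := abs (y : K).
pose p2 (y : borelType K) : R := abs ((y : K) - x).
have mp1 : measurable_fun setT p1 by exact: (measurable_radial_fun0 id).
have mp2 : measurable_fun setT p2 by exact: (measurable_radial_fun x id).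
have D2 : p2 @^-1` D = Kball n.
  by apply/seteqP; split => y /(abs_sub_ball _ hx).
rewrite -[X in (\int[mu]_(y in X) h (abs (y - x)%R))%E = _]D2.
rewrite -(ge0_integral_pushforward mp2)//; last exact: measurable_funTS.
transitivity (\int[pushforward mu p1]_(r in D) h r)%E; last first.
  by rewrite ge0_integral_pushforward//; exact: measurable_funTS.
apply: eq_measure_integral => A mA _; rewrite /pushforward.
rewrite -[RHS](haar_translate x); last by rewrite -[X in measurable X]setTI; exact: mp1.
congr (mu _); apply/seteqP; split => y /=.
  by move=> hy; exists (y - x); rewrite ?subrKC.
by move=> [z hz <-]; rewrite /p2/preimage/= addrC addKr.
Qed.

Lemma integral_radial_translate n x (h : R -> \bar R) :
  measurable_fun [set: R] h -> Kball n x ->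
  (\int[mu]_(y in Kball n) h (abs (y - x)%R) = \int[mu]_(y in Kball n) h (abs y))%E.
Proof.
move=> mh hx.
have split_parts (p : borelType K -> R) : (\int[mu]_(y in Kball n) h (p y) =
    \int[mu]_(y in Kball n) h^\+ (p y) - \int[mu]_(y in Kball n) h^\- (p y))%E.
  by rewrite integralE (funepos_comp h p) (funeneg_comp h p).
have := split_parts (fun y => abs ((y : K) - x)); move=> ->.
have := split_parts abs; move=> ->.
congr (_ - _)%E.
- exact: (ge0_integral_radial_translate (measurable_funepos mh) (funepos_ge0 h) hx).
- exact: (ge0_integral_radial_translate (measurable_funeneg mh) (funeneg_ge0 h) hx).
Qed.

Lemma integrable_radial_translate n x (h : R -> R) :
  measurable_fun [set: R] h -> Kball n x ->
  mu.-integrable (Kball n) (fun y => (h (abs y))%:E) ->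
  mu.-integrable (Kball n) (fun y => (h (abs (y - x)))%:E).
Proof.
move=> mh hx /integrableP[_ hi]; apply/integrableP; split.
  by apply: measurable_funTS; exact: (measurable_radial_fun x (EFin \o h)).
have mh' : measurable_fun [set: R] (fun r => `|(h r)%:E|%E).
  by do 2 apply: measurableT_comp => //.
by have -> := integral_radial_translate mh' hx.
Qed.

Variable alpha : R.
Hypothesis alpha0 : 0 < alpha.

(** The operator's kernel is a difference of two values of this function. *)
Definition radial_kernel (r : R) : R :=
  if alpha == 1 then ln r else r `^ (alpha - 1).

Lemma IkernelE x y :
  Ikernel abs alpha x y = radial_kernel (abs (y - x)) - radial_kernel (abs y).
Proof. by rewrite absB /Ikernel /radial_kernel; case: ifP. Qed.

Lemma measurable_radial_kernel : measurable_fun [set: R] radial_kernel.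
Proof.
by rewrite /radial_kernel; case: (alpha == 1);
  [exact: measurable_ln|exact: measurable_powR].
Qed.

(** This bounds the logarithm by powers of exponent greater than -1, which are
    integrable near the origin. *)
Lemma le_norm_ln (r : R) : 0 <= r -> `|ln r| <= r + 2 * r `^ (- 2^-1).
Proof.
rewrite le_eqVlt => /orP[/eqP<-|r0].
  by rewrite ln0// normr0 powR0 ?mulr0 ?addr0// oppr_eq0 invr_eq0.
rewrite ler_norml; apply/andP; split; last first.
  by rewrite (le_trans (ltW (ln_sublinear r0)))// lerDl mulr_ge0// powR_ge0.
(* Near 0, [- ln r = 2 * ln (r `^ (- 2^-1))]. *)
have := ltW (ln_sublinear (powR_gt0 (- 2^-1) r0)); rewrite ln_powR.
lra.
Qed.

Lemma integrable_radial_kernel n :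
  mu.-integrable (Kball n) (fun y => (radial_kernel (abs y))%:E).
Proof.
rewrite /radial_kernel; have [a1|a1] := eqVneq alpha 1; last first.
  by apply: integrable_abs_powR; move: alpha0; lra.
have mB : measurable (Kball n : set (borelType K)) by exact: measurable_le_abs.
have i1 : mu.-integrable (Kball n) (fun y => (abs y `^ 1)%:E).
  by apply: integrable_abs_powR; move: alpha0; lra.
have i2 : mu.-integrable (Kball n) (fun y => 2%:E * (abs y `^ (- 2^-1))%:E)%E.
  by apply: integrableZl => //; apply: integrable_abs_powR; lra.
apply: le_integrable (integrableD mB i1 i2) => //.
  by apply: measurable_funTS; exact: (measurable_radial_fun0 (EFin \o @ln R)).
move=> y _; rewrite -[X in (_ <= `|X|)%E]/((abs y `^ 1 + 2 * abs y `^ (- 2^-1))%:E).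
rewrite lee_fin; apply: le_trans (le_norm_ln (abs_ge0 y)) _.
by rewrite powRr1 ?abs_ge0//; exact: ler_norm.
Qed.

Lemma integrable_Ikernel n x : Kball n x ->
  mu.-integrable (Kball n) (fun y => (Ikernel abs alpha x y)%:E).
Proof.
move=> hx; rewrite (_ : (fun y => _) = fun y : K =>
    ((radial_kernel (abs (y - x)))%:E - (radial_kernel (abs y))%:E)%E); last first.
  by apply/funext => y; rewrite IkernelE EFinB.
apply: integrableB; [exact: measurable_le_abs| |exact: integrable_radial_kernel].
apply: integrable_radial_translate => //; first exact: measurable_radial_kernel.
exact: integrable_radial_kernel.
Qed.

(** The two terms of the kernel are translates of each other. *)
Lemma Rintegral_Ikernel n x : Kball n x ->
  \int[mu]_(y in Kball n) Ikernel abs alpha x y = 0.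
Proof.
move=> hx; rewrite (eq_Rintegral mu (g := fun y : borelType K =>
    radial_kernel (abs ((y : K) - x)) - radial_kernel (abs y))); last first.
  by move=> y _; rewrite IkernelE.
rewrite RintegralB; [|exact: measurable_le_abs| |exact: integrable_radial_kernel].
  rewrite /Rintegral (integral_radial_translate (h := EFin \o radial_kernel)) ?subrr//.
  by apply: measurableT_comp => //; exact: measurable_radial_kernel.
apply: integrable_radial_translate => //; first exact: measurable_radial_kernel.
exact: integrable_radial_kernel.
Qed.

(** * The operator on bounded radial functions *)

Lemma Ikernel_lt x y : abs y < abs x ->
  Ikernel abs alpha x y = radial_kernel (abs x) - radial_kernel (abs y).
Proof. by move=> yx; rewrite IkernelE absB abs_subl. Qed.

Lemma integrableM_radial n (k phi : K -> R) (C : R) :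
  mu.-integrable (Kball n) (fun y => (k y)%:E) ->
  radial_on abs (Kball n) phi -> (forall y, Kball n y -> `|phi y| <= C) ->
  mu.-integrable (Kball n) (fun y => (k y * phi y)%:E).
Proof.
move=> ik [w hw] hC; have mB := measurable_le_abs (q%:R ^ n).
rewrite (_ : (fun y => _) = ((EFin \o k) \* (EFin \o phi))%E); last first.
  by apply/funext => y; rewrite /= EFinM.
apply: (integrableMl mB ik).
  apply: (@eq_measurable_fun _ _ (borelType K) _ _ (fun y : K => w (abs y))).
    by move=> y /set_mem By; rewrite hw.
  by apply: measurable_funTS; exact: measurable_radial_fun0.
exists C; split=> [|r Cr y By]; first exact: num_real.
by apply: le_trans (ltW Cr); exact: hC.
Qed.

Lemma sphereE n x : abs x = q%:R ^ n -> [set y | abs y <= abs x] = Kball n.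
Proof. by move=> ->. Qed.

Lemma Iop_exists_radial n x (phi : K -> R) (C : R) :
  Kball n x -> x != 0 ->
  radial_on abs (Kball n) phi -> (forall y, Kball n y -> `|phi y| <= C) ->
  Iop_exists abs mu alpha phi x.
Proof.
move=> nx /abs_range[m hm] [w hw] hC.
have mn : Kball m `<=` Kball n by move=> y; rewrite /Kball/= -hm => /ball_trans; exact.
rewrite /Iop_exists (sphereE hm); apply: (@integrableM_radial _ _ _ C).
- by apply: integrable_Ikernel; rewrite /Kball/= hm.
- by exists w => y hy; apply: hw; exact: mn.
- by move=> y hy; apply: hC; exact: mn.
Qed.

Lemma eq_Iop x (phi psi : K -> R) :
  (forall y, abs y <= abs x -> phi y = psi y) ->
  Iop abs q mu alpha phi x = Iop abs q mu alpha psi x.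
Proof.
move=> h; rewrite /Iop; case: ifP => // _; congr (_ * _).
by apply: eq_Rintegral => y /set_mem/h ->.
Qed.

(** Since the kernel has integral 0 over the ball of [x], its product with
    [phi] has the same integral as its product with [phi - phi x]; the latter
    vanishes on the sphere of [x], and inside that sphere the kernel is radial.
    This makes [Iop phi] radial, and shows that the value of [phi] on the
    sphere of [x] enters only through the scalar [phi x]. *)
Lemma Iop_radialE n x (phi : K -> R) (C : R) :
  abs x = q%:R ^ n ->
  radial_on abs (Kball n) phi -> (forall y, Kball n y -> `|phi y| <= C) ->
  let k y := radial_kernel (q%:R ^ n) - radial_kernel (abs y) in
  Iop abs q mu alpha phi x = Icoef q alpha *
    (\int[mu]_(y in Kball n) (k y * phi y) - phi x * \int[mu]_(y in Kball n) k y).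
Proof.
move=> hx radphi hC k; have mB := measurable_le_abs (q%:R ^ n).
have bx : Kball n x by rewrite /Kball/= hx.
have ik : mu.-integrable (Kball n) (fun y => (k y)%:E).
  have icst : mu.-integrable (Kball n) (EFin \o cst (radial_kernel (q%:R ^ n))).
    apply: measurable_bounded_integrable => //; first by rewrite measure_ball ltry.
    by exists `|radial_kernel (q%:R ^ n)|; split=> [|r /ltW rC y _ //]; first exact: num_real.
  exact: (integrableB mB icst (integrable_radial_kernel n)).
have iK := integrable_Ikernel bx.
have ikphi := integrableM_radial ik radphi hC.
have cst_int (h : K -> R) : mu.-integrable (Kball n) (fun y => (h y)%:E) ->
    mu.-integrable (Kball n) (fun y => (phi x * h y)%:E).
  by move=> ih; exact: (integrableZl mB (phi x) ih).
have x0 : x == 0 = false.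
  by apply/negbTE; rewrite -abs_gt0 hx exprz_gt0.
rewrite /Iop x0; congr (_ * _); rewrite (sphereE hx).
rewrite (eq_Rintegral mu (g := fun y : borelType K =>
    (k y * phi y - phi x * k y) + phi x * Ikernel abs alpha x y)); last first.
  (* Inside the sphere of [x] the kernel equals [k]; on it [k y = 0] and
     [phi y = phi x]. *)
  move=> y /set_mem By; have [yx|yx] := ltP (abs (y : K)) (abs x).
    by rewrite Ikernel_lt// hx -/(k y) [k y * _]mulrC; ring.
  have yE : abs y = abs x by apply/eqP; rewrite eq_le yx hx andbT.
  have [w hw] := radphi.
  by rewrite /k yE hx subrr !mul0r mulr0 subrr add0r mulrC !hw// yE.
rewrite RintegralD//; last 2 first.
- exact: (integrableB mB ikphi (cst_int _ ik)).
- exact: cst_int.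
rewrite RintegralB//; last exact: cst_int.
by rewrite !RintegralZl// Rintegral_Ikernel// mulr0 addr0.
Qed.

(** * Continuation of solutions *)

Variables (u0 : R) (f : R -> R -> R) (M : R).
Hypothesis f_bounded : forall t (x : R), t != 0 -> `|f (abs t) x| <= M.
Hypothesis f_continuous : forall t, t != 0 -> continuous (f (abs t)).

Let solution D u := solution_on abs q mu alpha D u0 f u.

Lemma radial_superposition D u :
  radial_on abs D u -> radial_on abs D (fun y => f (abs y) (u y)).
Proof. by case=> w hw; exists (fun r => f r (w r)) => y /hw ->. Qed.

(** The hypothesis on [f] says nothing about [f 0], and the integrals range
    over balls that contain the origin. *)
Lemma superposition_bounded u y :
  `|f (abs y) (u y)| <= Num.max M `|f 0 (u 0)|.
Proof.
rewrite le_max; have [->|y0] := eqVneq y 0; first by rewrite abs0 lexx orbT.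
by rewrite f_bounded.
Qed.

(** The existence of the integrals is automatic, [f] being bounded. *)
Lemma solution_ballP n u : radial_on abs (Kball n) u ->
  (forall t, Kball n t -> u t = u0 + Iop abs q mu alpha (fun y => f (abs y) (u y)) t) ->
  solution (Kball n) u.
Proof.
move=> ru hu; split=> // t tn t0.
apply: (Iop_exists_radial tn t0 (radial_superposition ru)) => y _.
exact: superposition_bounded.
Qed.

(** Boundedness makes [s - h s] change sign, so the intermediate value theorem
    applies. *)
Lemma bounded_continuous_fixpoint (h : R -> R) (C : R) :
  continuous h -> (forall s, `|h s| <= C) -> exists s, s = h s.
Proof.
move=> hc hC; have C0 : 0 <= C by exact: le_trans (hC 0).
have [|||s _ hs] := @IVT R (fun s => s - h s) (- C) C 0.
- by rewrite ge0_cp.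
- by apply: continuous_subspaceT => s; apply: cvgB; [exact: cvg_id|exact: hc].
- have /andP[? ?] : - C <= h C <= C by rewrite -ler_norml.
  have /andP[? ?] : - C <= h (- C) <= C by rewrite -ler_norml.
  by rewrite ge_min le_max !subr_ge0 !subr_le0; apply/andP; split; apply/orP; [left|right].
- by exists s; apply/eqP; rewrite -subr_eq0 hs.
Qed.

(** On the sphere added to the ball the equation reduces to one scalar fixed
    point problem for the constant value [z] taken there. *)
Lemma solution_extend_sphere n u : solution (Kball n) u ->
  exists v, solution (Kball (n + 1)) v /\ forall t, Kball n t -> v t = u t.
Proof.
move=> [[w hw] _ hu]; have [x0 x0n0 x0E] := abs_surj (n + 1).
set r : R := q%:R ^ (n + 1) in x0E.
pose k y := radial_kernel r - radial_kernel (abs y).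
pose J := \int[mu]_(y in Kball (n + 1)) (k y * f (abs (y : K)) (u y)).
pose D := \int[mu]_(y in Kball (n + 1)) k y.
have [z hz] : exists z : R, z = u0 + Icoef q alpha * (J - f r z * D).
  apply: (@bounded_continuous_fixpoint _
    (`|u0| + `|Icoef q alpha| * (`|J| + M * `|D|))) => s.
    apply: cvgD; first exact: cvg_cst.
    apply: cvgMr; apply: cvgB; first exact: cvg_cst.
    by apply: cvgMl; rewrite -x0E; exact: f_continuous.
  rewrite (le_trans (ler_normD _ _))// lerD2l normrM ler_wpM2l//.
  rewrite (le_trans (ler_normB _ _))// lerD2l normrM ler_wpM2r//.
  by rewrite -x0E f_bounded.
pose v y := if abs y <= q%:R ^ n then u y else z.
have vu t : Kball n t -> v t = u t by rewrite /Kball/v/= => ->.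
have rv : radial_on abs (Kball (n + 1)) v.
  exists (fun s => if s <= q%:R ^ n then w s else z) => y _.
  by rewrite /v; case: ifP => // /hw.
exists v; split=> //; apply: solution_ballP => // t.
have [tn _|tn tn1] := pselect (Kball n t).
  rewrite vu// hu//; congr (_ + _); apply: eq_Iop => y yt.
  by rewrite vu//; exact: ball_trans yt tn.
have tE : abs t = r by apply: abs_ball_top; rewrite ?addrK.
rewrite (Iop_radialE tE (radial_superposition rv) (fun y _ => superposition_bounded v y)).
have -> : v t = z by rewrite /v; case: ifP.
rewrite tE {1}hz; congr (_ + _ * (_ - _)).
(* [J] was formed with [u], which differs from [v] only where [k] vanishes. *)
apply: eq_Rintegral => y /set_mem yn1.
have [yn|yn] := pselect (Kball n y); first by rewrite vu.
by rewrite /k (abs_ball_top yn1) ?addrK// subrr !mul0r.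
Qed.

(** The integral equation at [t] sees only the ball of [t], so solutions on an
    exhausting sequence of balls glue. *)
Lemma solution_glue n u (V : nat -> K -> R) :
  (forall k, solution (Kball (n + k%:Z)) (V k)) ->
  (forall k t, Kball (n + k%:Z) t -> u t = V k t) -> solution setT u.
Proof.
move=> hV uV; have ru : radial_on abs setT u.
  exists (fun r => u (xget 0 [set x | abs x = r])) => y _.
  have yE : abs (xget 0 [set x | abs x = abs y]) = abs y.
    exact: (@xgetI _ 0 [set x | abs x = abs y] y).
  have [k hk] := ball_exhaust n y; have [[w hw] _ _] := hV k.
  have hk' : Kball (n + k%:Z) (xget 0 [set x | abs x = abs y]).
    by rewrite /Kball/= yE.
  by rewrite (uV _ _ hk) (uV _ _ hk') !hw// yE.
split=> // t _; have [k hk] := ball_exhaust n t.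
  move=> t0; have [w hw] := radial_superposition ru.
  apply: (Iop_exists_radial hk t0) => [|y _]; last exact: superposition_bounded.
  by exists w => y _; exact: hw.
have [_ _ hVk] := hV k; rewrite (uV _ _ hk) hVk//; congr (_ + _).
by apply: eq_Iop => y yt; rewrite (uV k)//; exact: ball_trans yt hk.
Qed.

Lemma solution_continuation n u : solution (Kball n) u ->
  exists v, solution setT v /\ forall t, Kball n t -> v t = u t.
Proof.
move=> hu.
have /choice[E hE] : forall p : int * (K -> R), exists v, solution (Kball p.1) p.2 ->
    solution (Kball (p.1 + 1)) v /\ forall t, Kball p.1 t -> v t = p.2 t.
  move=> [m w]; have [/solution_extend_sphere[v hv]|nw] := pselect (solution (Kball m) w).
    by exists v.
  by exists w => /nw.
pose V := fix V k := if k is j.+1 then E (n + j%:Z, V j) else u.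
have hV k : solution (Kball (n + k%:Z)) (V k).
  elim: k => [|k IH]; first by rewrite addr0.
  by rewrite -addn1 PoszD addrA addn1; have [] := hE (_, _) IH.
have stable i k t : (i <= k)%N -> Kball (n + i%:Z) t -> V k t = V i t.
  move=> /subnK <- ti; elim: (k - i)%N => // j IH.
  rewrite addSn -IH; have [_ step] := hE (_, _) (hV (j + i)%N); apply: step.
  by apply: (@ball_homo (n + i%:Z)) => //; rewrite lerD2l lez_nat leq_addl.
have /choice[depth hdepth] := ball_exhaust n.
have vV k t : Kball (n + k%:Z) t -> V (depth t) t = V k t.
  by move=> tk; have [ki|/ltnW ik] := leqP k (depth t); [|symmetry]; exact: stable.
exists (fun t => V (depth t) t); split; first exact: solution_glue hV vV.
by move=> t tn; rewrite (vV 0%N) ?addr0.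
Qed.
End LocalFieldTheory.

Theorem theorem2 (R : realType) (K : topologicalFieldType)
    (hK : nonarchimedean_local_field K)
    (q : nat) (abs : K -> R) (habs : normalized_absolute_value abs q)
    (mu : {measure set (borelType K) -> \bar R})
    (hmu : normalized_haar_measure abs mu)
    (alpha : R) (halpha : 0 < alpha) (u0 : R)
    (f : R -> R -> R) (M F : R) (hM : 0 < M) (hF : 0 < F)
    (f_bounded : forall (t : K) (x : R), t != 0 -> `|f (abs t) x| <= M)
    (f_lipschitz : forall (t : K) (x y : R), t != 0 ->
       `|f (abs t) x - f (abs t) y| <= F * `|x - y|)
    (Fl : int -> R)
    (hFl : forall l : int, 0 < Fl l < q%:R `^ (- alpha * l%:~R))
    (f_lipschitz_l : forall (l : int) (x y : R),
       `|f (q%:R ^ l) x - f (q%:R ^ l) y| <= Fl l * `|x - y|)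
    (N : int) (u : K -> R)
    (hu : solution_on abs q mu alpha [set t | abs t <= q%:R ^ N] u0 f u) :
  exists v : K -> R,
    solution_on abs q mu alpha [set: K] u0 f v /\
    (forall t : K, abs t <= q%:R ^ N -> v t = u t).
Proof.
have f_continuous t : t != 0 -> continuous (f (abs t)).
  move=> t0 x; apply/cvgrPdist_lt => e e0; near=> y.
  rewrite (le_lt_trans (f_lipschitz _ _ _ t0))// mulrC -ltr_pdivlMr//.
  by near: y; apply: cvgr_dist_lt => //; exact: divr_gt0.
exact: (solution_continuation habs hmu halpha f_bounded f_continuous hu).
Unshelve. all: by end_near.
Qed.
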